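(* Suppose that $t\geq 2$ is an integer. Let $cd_t(n)$ be the number of $t$-core partitions of size $n$ with distinct parts. Then the generating function for such partitions is $$\sum_{n\geq 0}cd_t(n)q^n=\sum_{(n_1,n_2,\ldots,n_{t-1})\in \mathcal{C}_t}q^{\sum_{i=1}^{t-1}\left(in_i+t\binom{n_i}{2}\right)-\binom{\sum_{i=1}^{t-1}n_i}{2}},$$ where $\mathcal{C}_t=\{ (x_1,x_2,\ldots,x_{t-1})\in\mathbb{N}^{t-1}: x_ix_{i+1}=0 \text{ for } 1\leq i\leq t-2 \}$. In particular, when $t=2,3,4$, we have $$\sum_{n\geq 0}cd_2(n)q^n=\sum_{n\geq 0}q^{\binom{n+1}{2}},$$ $$\sum_{n\geq 0}cd_3(n)q^n=\sum_{n\geq 1}q^{n^2}+\sum_{n\geq 0}q^{2\binom{n+1}{2}},$$ and $$\sum_{n\geq 0}cd_4(n)q^n=\sum_{n\geq 1}q^{\frac{n(3n+1)}{2}}+\sum_{n\geq 0}\sum_{m\geq 0}q^{\frac{n(3n-1)+3m(m+1)-2mn}{2}}.$$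
   Context: $\mathbb{N}$ denotes the set of nonnegative integers (including $0$). A partition is a finite nonincreasing sequence $\lambda=(\lambda_1,\lambda_2,\ldots,\lambda_\ell)$ of positive integers (the empty partition, $\ell=0$, is included); the $\lambda_i$ are its parts and $|\lambda|=\sum_{i=1}^{\ell}\lambda_i$ is its size. A partition has distinct parts if no two of its parts are equal. $\lambda$ is identified with its Young diagram, the collection of left-justified rows with $\lambda_i$ boxes in the $i$-th row. The hook length $h(i,j)$ of the box $(i,j)$ in the $i$-th row and $j$-th column is the number of boxes that are exactly to the right of it (same row), or exactly below it (same column), or the box itself. A partition is a $t$-core partition if none of its boxes has hook length equal to $t$. The generating functions are formal power series in $q$. *)

(* Defs.v *)
From mathcomp Require Import all_boot all_order all_algebra.
From mathcomp Require Import finmap.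
From mathcomp Require Import mathcomp_extra boolp classical_sets functions.
From mathcomp Require Import cardinality fsbigop.

Set Implicit Arguments.
Unset Strict Implicit.
Unset Printing Implicit Defensive.

Import GRing.Theory Num.Theory.

Local Open Scope classical_set_scope.

Definition is_partition (la : seq nat) : bool :=
  sorted geq la && all (fun p => 0 < p)%N la.

(* Rows and columns are numbered from 0. *)
Definition young_diagram (la : seq nat) : seq (nat * nat) :=
  [seq (i, j) | i <- iota 0 (size la), j <- iota 0 (nth 0%N la i)].

Definition hook_length (la : seq nat) (b : nat * nat) : nat :=
  count (fun c => [|| (c.1 == b.1) && (b.2 < c.2)%N,
                      (c.2 == b.2) && (b.1 < c.1)%N
                    | c == b])
        (young_diagram la).

Definition is_core (t : nat) (la : seq nat) : bool :=
  all (fun b => hook_length la b != t) (young_diagram la).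

Definition distinct_cores (t n : nat) : set (seq nat) :=
  [set la | [/\ is_partition la, uniq la, sumn la = n & is_core t la]].

(* [fset_set] sends infinite sets to the empty one, so the cardinality below
   is the intended one because of this lemma. *)
Lemma finite_distinct_cores (t n : nat) : finite_set (distinct_cores t n).
Proof.
apply: (@sub_finite_set _ _
  ((fun b : n.-bseq 'I_n.+1 => map val b) @` setT)); last first.
  by apply: finite_image; apply: finite_finset.
move=> la [/andP[_ pos_la] _ sum_la _].
have size_la : (size la <= n)%N.
  rewrite -sum_la; elim: la pos_la {sum_la} => //= p la IHla /andP[p_gt0 /IHla].
  by rewrite -add1n; apply: leq_add.
have le_la : {in la, forall p, p < n.+1}%N.
  move=> p; rewrite ltnS -sum_la; elim: la {pos_la sum_la size_la} => //= r la IHla.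
  rewrite inE => /predU1P[->|/IHla le_p]; first exact: leq_addr.
  exact: leq_trans le_p (leq_addl _ _).
have size_inord : (size (map (@inord n) la) <= n)%N by rewrite size_map.
exists (Bseq size_inord) => //=; rewrite -map_comp.
by apply: map_id_in => p /le_la p_lt /=; rewrite inordK.
Qed.

Definition cd (t n : nat) : nat := #|` fset_set (distinct_cores t n)|.

Local Open Scope ring_scope.

(* A formal power series in q is the sequence of its coefficients; series are
   added with the pointwise addition of functions. *)
Notation fps := (nat -> int).

Definition genfun (a : nat -> nat) : fps := fun n => (a n)%:Z.

(* The monomial q ^ k. For k < 0 there is no such power series and the value
   is 0, so exponents have to be known to be nonnegative. *)
Definition qpow (k : int) : fps := fun n => (n%:Z == k)%:R.

(* An infinite sum of power series is well defined when each coefficient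
   receives finitely many nonzero contributions; otherwise the finitely
   supported sum in [fps_sum] takes the value 0. *)
Definition fps_summable (I : choiceType) (D : set I) (f : I -> fps) : Prop :=
  forall n, finite_set [set i | D i /\ f i n <> 0].

Definition fps_sum (I : choiceType) (D : set I) (f : I -> fps) : fps :=
  fun n => \sum_(i \in D) f i n.

(* The tuple (n_1, ..., n_(t-1)) is indexed from 0: n_i is [tnth x] at i - 1. *)
Definition C_set (t : nat) : set (t.-1.-tuple nat) :=
  [set x | forall i j : 'I_t.-1, nat_of_ord j = i.+1 ->
             (tnth x i * tnth x j = 0)%N].
Arguments C_set t : clear implicits.

Definition C_exponent (t : nat) (x : t.-1.-tuple nat) : int :=
  (\sum_(i < t.-1) (i.+1 * tnth x i + t * 'C(tnth x i, 2)))%N%:Z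
  - 'C((\sum_(i < t.-1) tnth x i)%N, 2)%:Z.

(* Main.v *)
Require Import Defs.
From mathcomp Require Import all_boot all_order all_algebra.
From mathcomp Require Import finmap.
From mathcomp Require Import mathcomp_extra boolp classical_sets functions.
From mathcomp Require Import cardinality fsbigop.
From mathcomp Require Import zify.

(** Let X be the set of hook lengths of the first column of a partition (its
    beta numbers).  The partition is recovered from X, which can be any finite
    set of positive integers ([betaK], [unbetaK]).  Three facts translate the
    problem to X:
    - the size of the partition is the sum of X minus 'C(#X, 2)
      ([sumn_beta]);
    - the parts are distinct if and only if X has no two consecutive elements
      ([uniq_beta_nonconsecutive]);
    - the hook lengths in the row of a beta number x are the differences x - y
      over the nonnegative integers y < x that are not beta numbers, so the
      partition is a t-core if and only if x - t is in X whenever x in X is at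
      least t ([is_core_beta_closed]).

    Since 0 is not in X, a set closed under subtraction of t contains no
    multiple of t, and it is determined by the number n_i of its elements in
    each residue class i = 1, ..., t - 1: these elements are
    i, i + t, ..., i + (n_i - 1) t.  Their sum is i n_i + t 'C(n_i, 2), which
    gives the exponent of the theorem, and the absence of consecutive elements
    becomes n_i n_(i+1) = 0 for all i.  This bijection is [core_of_bij].  It
    also shows that the exponents are nonnegative and that each value is taken
    finitely often, so that the sum over tuples is well defined.

    For t = 2, 3, 4 the set of tuples is parametrized by one or two explicit
    injective families with disjoint images, and the sum is reindexed along
    them; for t = 4 the second family has two parameters and its sum is then
    written as an iterated sum. *)

Set Implicit Arguments.
Unset Strict Implicit.
Unset Printing Implicit Defensive.

Import GRing.Theory Num.Theory.

(** * First column hook lengths *)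

(** A partition is encoded by the set of hook lengths of its first column,
    which turns hook conditions on the diagram into conditions on a set of
    integers.  The box (i, 0) has la_i boxes in its row and one box in
    each row below it, whence the formula. *)
Fixpoint beta (la : seq nat) : seq nat :=
  if la is p :: la' then p + size la' :: beta la' else [::].

Fixpoint unbeta (X : seq nat) : seq nat :=
  if X is x :: X' then x - size X' :: unbeta X' else [::].

Lemma size_beta la : size (beta la) = size la.
Proof. by elim: la => //= p la ->. Qed.

Lemma size_unbeta X : size (unbeta X) = size X.
Proof. by elim: X => //= x X ->. Qed.

Lemma betaK : cancel beta unbeta.
Proof. by elim=> //= p la ->; rewrite size_beta addnK. Qed.

(** The shifts added to the parts are 0, 1, ..., size la - 1; their sum is the
    binomial coefficient that C_exponent subtracts. *)
Lemma sumn_beta la : sumn (beta la) = sumn la + 'C(size la, 2).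
Proof. by elim: la => //= p la ->; rewrite binS bin1; lia. Qed.

Lemma sorted_geq_cons p la :
  sorted geq (p :: la) = all (geq p) la && sorted geq la.
Proof. exact: path_sortedE (rev_trans leq_trans) _ _. Qed.

Lemma sorted_gtn_cons x X :
  sorted gtn (x :: X) = all (gtn x) X && sorted gtn X.
Proof. exact: path_sortedE (rev_trans ltn_trans) _ _. Qed.

Lemma is_partition_cons p la :
  is_partition (p :: la) = [&& 0 < p, all (geq p) la & is_partition la].
Proof.
rewrite /is_partition sorted_geq_cons /=.
by case: (all (geq p) la); case: (0 < p); rewrite /= ?andbF.
Qed.

Lemma beta_lt p la : all (geq p) la -> all (gtn (p + size la)) (beta la).
Proof.
elim: la p => //= r la IH p /andP[le_rp le_la]; apply/andP; split; first by lia.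
by apply: sub_all (IH p le_la) => y /=; lia.
Qed.

Lemma beta_sorted_gt0 la : is_partition la ->
  sorted gtn (beta la) && all (leq 1) (beta la).
Proof.
elim: la => // p la IH.
rewrite is_partition_cons => /and3P[p0 lap /IH /andP[s a]].
rewrite [beta _]/= sorted_gtn_cons s (beta_lt lap) /= a andbT; lia.
Qed.

(** What keeps the truncated subtraction in [unbeta] exact. *)
Lemma size_sorted_lt x X : path gtn x X -> all (leq 1) X -> size X <= x.-1.
Proof.
elim: X x => //= y X IH x /andP[xy /IH h] /andP[y0 /h]; lia.
Qed.

Lemma unbetaK X : sorted gtn X -> all (leq 1) X -> beta (unbeta X) = X.
Proof.
elim: X => //= x X IH p /andP[x0 a].
rewrite (IH (path_sorted p) a) size_unbeta subnK //.
by have := size_sorted_lt p a; lia.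
Qed.

Lemma is_partition_unbeta X :
  sorted gtn X -> all (leq 1) X -> is_partition (unbeta X).
Proof.
case: X => // x X /=.
rewrite /is_partition /=.
elim: X x => [|y X IH] x /=; first by lia.
case/andP=> xy p /and3P[x0 y0 a].
have /= := IH y p; rewrite y0 => /(_ a) /and3P[-> yX ->].
have := size_sorted_lt p a; lia.
Qed.

(** Successive beta numbers differ by the difference of the parts plus one, so
    two of them are consecutive exactly when two parts are equal. *)
Lemma uniq_beta_nonconsecutive la : is_partition la ->
  uniq la <-> (forall y, y \in beta la -> y.+1 \notin beta la).
Proof.
elim: la => // p la IH.
rewrite is_partition_cons => /and3P[_ ge_la pla].
have {IH} := IH pla.
have /allP lt_la := beta_lt ge_la.
case: la ge_la pla lt_la => [|r la] ge_la pla lt_la IH.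
  by split=> //= _ y; rewrite !inE => /eqP ->; rewrite gtn_eqF.
have le_rp : r <= p by case/andP: (ge_la).
move: (pla); rewrite is_partition_cons => /and3P[_ ge_r _].
have /allP lt_r := beta_lt ge_r.
have [eq_rp|ne_rp] := eqVneq p r.
  rewrite cons_uniq eq_rp mem_head /=; split=> // nc.
  have := nc (r + size la); rewrite /= !inE eqxx orbT => /(_ isT).
  by rewrite addnS eqxx.
have p_la : p \notin la by apply/negP => /(allP ge_r) /=; lia.
rewrite cons_uniq inE (negbTE ne_rp) (negbTE p_la) IH /=; split=> nc y.
  rewrite inE => /predU1P[->|yX]; rewrite inE negb_or.
    rewrite gtn_eqF //=; apply/negP => /lt_la /=; lia.
  rewrite nc // andbT.
  by move: yX; rewrite inE => /predU1P[|/lt_r /=]; lia.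
move=> yX; have := nc y; rewrite inE yX orbT inE negb_or => /(_ isT).
by case/andP.
Qed.

(** * Cores in terms of beta numbers *)

(** Removing the first row of a diagram leaves the hooks of all other boxes
    unchanged, so hook conditions can be checked by induction on the rows. *)
Lemma young_diagram_cons p la : young_diagram (p :: la) =
  [seq (0, j) | j <- iota 0 p] ++ [seq (c.1.+1, c.2) | c <- young_diagram la].
Proof.
rewrite /young_diagram /=; congr (_ ++ _).
rewrite (iotaDl 1 0) -map_comp map_flatten -map_comp; congr flatten.
by apply: eq_map => i /=; rewrite -map_comp.
Qed.

Lemma young_diagram_col la j :
  count (fun c => c.2 == j) (young_diagram la) = count (fun r => j < r) la.
Proof.
elim: la => //= p la IH.
rewrite young_diagram_cons count_cat !count_map -IH; congr (_ + _).
rewrite -(@eq_count _ (pred1 j)) // count_uniq_mem ?iota_uniq //.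
by rewrite mem_iota.
Qed.

Lemma count_geq_iota j p : count (leq j) (iota 0 p) = p - j.
Proof. by elim: p => // p IH; rewrite -addn1 iotaD count_cat IH /=; lia. Qed.

Lemma hook_length_row0 p la j : j < p ->
  hook_length (p :: la) (0, j) = p - j + count (fun r => j < r) la.
Proof.
move=> jp; rewrite /hook_length young_diagram_cons count_cat !count_map.
rewrite -young_diagram_col -count_geq_iota; congr (_ + _).
  by apply: eq_count => k /=; rewrite andbF xpair_eqE /=; lia.
by apply: eq_count => -[a b] /=; rewrite xpair_eqE /= orbF andbT.
Qed.

Lemma hook_length_rowS p la i j :
  hook_length (p :: la) (i.+1, j) = hook_length la (i, j).
Proof.
rewrite /hook_length young_diagram_cons count_cat !count_map.
rewrite (@eq_count _ _ pred0) ?count_pred0; last by move=> k /=; rewrite andbF.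
by apply: eq_count => -[a b] /=; rewrite !xpair_eqE eqSS.
Qed.

(** The integers that are not beta numbers are indexed by columns: read the
    boundary path of the diagram from the bottom left corner; its vertical
    steps are the beta numbers, and the horizontal step under column j comes
    after j horizontal steps and one vertical step for each part at most j. *)
Lemma notin_betaP la y : sorted geq la ->
  reflect (exists j, y = j + count (geq j) la) (y \notin beta la).
Proof.
elim: la y => [|p la IH] y /=; first by left; exists y; rewrite addn0.
move=> s; have {}IH := IH ^~ (path_sorted s).
have gela : all (geq p) la.
  by move: s; rewrite -/(sorted geq (_ :: _)) sorted_geq_cons => /andP[].
have full j : p <= j -> count (geq j) la = size la.
  move=> pj; apply/eqP; rewrite -all_count; apply: sub_all gela => r /=; lia.
apply: (iffP idP).
  rewrite inE negb_or => /andP[ne /IH[j e]].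
  case: (ltnP j p) => jp; first by exists j; rewrite e /=; lia.
  rewrite full // in e; exists j.-1; rewrite full; lia.
case=> j; case: (leqP p j) => jp.
  rewrite full // => e; rewrite inE negb_or; apply/andP; split; first by lia.
  by apply/IH; exists j.+1; rewrite full; lia.
rewrite add0n => e; rewrite inE negb_or; apply/andP; split; last first.
  by apply/IH; exists j.
by have := count_size (geq j) la; lia.
Qed.

(** By [notin_betaP], subtracting from the first beta number the hook lengths
    of the boxes of the first row gives exactly the smaller integers that are
    not beta numbers. *)
Lemma core_first_row t p la : sorted geq (p :: la) ->
  (forall j, j < p -> p - j + count (fun r => j < r) la != t) <->
  (0 < t -> t <= p + size la -> p + size la - t \in beta la).
Proof.
move=> s.
have cnt j : count (fun r => j < r) la + count (geq j) la = size la.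
  rewrite -(count_predC (geq j) la) addnC; congr (_ + _).
  by apply: eq_count => r /=; lia.
have gela : all (geq p) la by move: s; rewrite sorted_geq_cons => /andP[].
split.
  (* A column index j >= p would yield an integer beyond the first beta
     number, so the missing integer comes from a box of the first row. *)
  move=> h t0 tp; apply/negPn/negP => /(notin_betaP _ (path_sorted s))[j e].
  case: (ltnP j p) => jp; first by have := h j jp; have := cnt j; lia.
  have : count (geq j) la = size la; last by lia.
  by apply/eqP; rewrite -all_count; apply: sub_all gela => r /=; lia.
move=> h j jp; apply/eqP => e.
have := cnt j => ?.
have /negP[] : p + size la - t \notin beta la; last by apply: h; lia.
by apply/(notin_betaP _ (path_sorted s)); exists j; lia.
Qed.

(** The classical criterion.  Since 0 is never a beta number here, closure also
    says that t itself, and hence any multiple of t, is not one. *)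
Lemma is_core_beta_closed t la : 0 < t -> is_partition la ->
  is_core t la <-> (forall x, x \in beta la -> t <= x -> x - t \in beta la).
Proof.
move=> t0; elim: la => // p la IH.
rewrite is_partition_cons => /and3P[p0 gela pla].
have s : sorted geq (p :: la).
  by rewrite sorted_geq_cons gela; case/andP: pla.
have {}IH := IH pla.
have lt_la := allP (beta_lt gela).
have -> : is_core t (p :: la) <->
    (forall j, j < p -> p - j + count (fun r => j < r) la != t) /\ is_core t la.
  rewrite /is_core young_diagram_cons all_cat !all_map /=.
  split=> [/andP[h1 h2]|[h1 h2]].
    split=> [j jp|].
      by rewrite -hook_length_row0 //; apply: (allP h1); rewrite mem_iota.
    by apply: sub_all h2 => -[i j] /=; rewrite hook_length_rowS.
  apply/andP; split.
    apply/allP => j; rewrite mem_iota => /= jp.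
    by rewrite hook_length_row0 // h1.
  by apply: sub_all h2 => -[i j] /=; rewrite hook_length_rowS.
rewrite core_first_row // IH /=; split.
  case=> h1 h2 x; rewrite !inE => /predU1P[->|xX] tx; apply/orP; right.
    exact: h1.
  exact: h2.
move=> h; split=> [_ tp|x xX tx].
  have := h _ (mem_head _ _) tp; rewrite inE => /predU1P[|//]; lia.
have := h x; rewrite !inE xX orbT => /(_ isT tx) /predU1P[|//].
by have := lt_la _ xX => /=; lia.
Qed.

(** * The abacus of a tuple *)

(** A set closed under subtraction of t is cut by the residue classes into
    initial segments of the runners i.+1, i.+1 + t, i.+1 + 2 t, ...; the tuple
    lists their lengths.  The runner of multiples of t is empty. *)
Definition abacus_beads t (x : t.-1.-tuple nat) : seq nat :=
  [seq i.+1 + k * t | i : 'I_t.-1 <- enum 'I_t.-1,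
                      k : nat <- iota 0 (tnth x i)].

Definition abacus t (x : t.-1.-tuple nat) : seq nat :=
  sort geq (abacus_beads x).

Definition core_of t (x : t.-1.-tuple nat) : seq nat := unbeta (abacus x).

Lemma bead_inj t (i j : 'I_t.-1) k l :
  i.+1 + k * t = j.+1 + l * t -> i = j /\ k = l.
Proof.
have lt_t (m : 'I_t.-1) : m.+1 < t by have := ltn_ord m; lia.
move=> e; have /eqP := congr1 (modn^~ t) e.
rewrite /= ![_.+1 + _]addnC !modnMDl !modn_small // eqSS => /eqP eij.
split; first exact: val_inj.
have t0 : 0 < t by have := lt_t i; lia.
by apply/eqP; rewrite -(eqn_pmul2r t0); apply/eqP; lia.
Qed.

Lemma mem_abacusP t (x : t.-1.-tuple nat) y :
  reflect (exists (i : 'I_t.-1) k, k < tnth x i /\ y = i.+1 + k * t)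
          (y \in abacus x).
Proof.
rewrite mem_sort; apply: (iffP allpairsPdep).
  by move=> [i [k [_ + ->]]]; rewrite mem_iota => kx; exists i, k.
by move=> [i [k [kx ->]]]; exists i, k; rewrite mem_enum mem_iota.
Qed.

Lemma mem_abacus t (x : t.-1.-tuple nat) (i : 'I_t.-1) k :
  (i.+1 + k * t \in abacus x) = (k < tnth x i).
Proof.
apply/mem_abacusP/idP => [[j [l [lx /bead_inj[-> ->]]]] //|kx].
by exists i, k.
Qed.

Lemma sorted_abacus t (x : t.-1.-tuple nat) : sorted gtn (abacus x).
Proof.
rewrite gtn_sorted_uniq_geq sort_uniq sort_sorted; last first.
  by move=> m n; apply: leq_total.
rewrite andbT; apply: allpairs_uniq_dep; first exact: enum_uniq.
  by move=> i _; apply: iota_uniq.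
by move=> [i k] [j l] _ _ /= /bead_inj[-> ->].
Qed.

Lemma abacus_gt0 t (x : t.-1.-tuple nat) : all (leq 1) (abacus x).
Proof. by apply/allP => y /mem_abacusP[i [k [_ ->]]]. Qed.

Lemma abacus_closed t (x : t.-1.-tuple nat) y :
  y \in abacus x -> t <= y -> y - t \in abacus x.
Proof.
move=> /mem_abacusP[i [k [kx ->]]] le_t.
have : i < t.-1 by []. case: k kx le_t => [|k] kx le_t lt_i; first by lia.
by rewrite mulSn addnCA addKn mem_abacus; lia.
Qed.

Lemma sumn_abacus t (x : t.-1.-tuple nat) :
  sumn (abacus x) = \sum_(i < t.-1) (i.+1 * tnth x i + t * 'C(tnth x i, 2)).
Proof.
rewrite (perm_sumn (permEl (perm_sort _ _))) sumnE big_allpairs_dep big_enum /=.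
apply: eq_bigr => i _; rewrite -[X in iota 0 X]subn0.
rewrite big_split /= sum_nat_const_nat subn0 -bin2_sum.
by rewrite -big_distrl /= /index_iota subn0; congr (_ + _); apply: mulnC.
Qed.

Lemma size_abacus t (x : t.-1.-tuple nat) :
  size (abacus x) = \sum_(i < t.-1) tnth x i.
Proof.
rewrite size_sort size_allpairs_dep sumnE big_map big_enum /=.
by apply: eq_bigr => i _; rewrite size_iota.
Qed.

(** If two adjacent runners are both nonempty, their first beads are
    consecutive.  The residue t - 1 is no exception: the successors of its
    beads are multiples of t, which are never beads. *)
Lemma C_set_nonconsecutive t (x : t.-1.-tuple nat) :
  C_set t x <-> (forall y, y \in abacus x -> y.+1 \notin abacus x).
Proof.
split=> [Cx y /mem_abacusP[i [k [kx ->]]]|nc i j e].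
  apply/negP => /mem_abacusP[j [l [lx e]]].
  have [lti ltj] : i < t.-1 /\ j < t.-1 by [].
  have [eij|ne] := eqVneq (nat_of_ord j) i.+1.
    by have /eqP := Cx i j eij; rewrite muln_eq0; lia.
  move: ne; case: (ltnP i.+1 t.-1) => [lt_i ne|ge_i _].
    have /bead_inj [] : (Ordinal lt_i).+1 + k * t = j.+1 + l * t.
      by rewrite -e addSn.
    by move=> /(congr1 val) /= ? _; lia.
  have {}e : (k.+1 * t = j.+1 + l * t)%N by rewrite -e; lia.
  have /eqP := congr1 (modn^~ t) e; rewrite modnMl addnC modnMDl.
  by rewrite modn_small //; lia.
apply/eqP; rewrite muln_eq0 !eqn0Ngt; have := nc i.+1.
have := mem_abacus x i 0; have := mem_abacus x j 0.
by rewrite e !mul0n !addn0 => -> -> h; case: (0 < tnth x i) h => //= ->.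
Qed.

Lemma beta_core_of t (x : t.-1.-tuple nat) : beta (core_of x) = abacus x.
Proof. exact: unbetaK (sorted_abacus x) (abacus_gt0 x). Qed.

Lemma is_partition_core_of t (x : t.-1.-tuple nat) : is_partition (core_of x).
Proof. exact: is_partition_unbeta (sorted_abacus x) (abacus_gt0 x). Qed.

(** In particular the exponent, a difference, is nonnegative. *)
Lemma C_exponentE t (x : t.-1.-tuple nat) :
  C_exponent x = Posz (sumn (core_of x)).
Proof.
rewrite /C_exponent -sumn_abacus -size_abacus -beta_core_of sumn_beta size_beta.
by rewrite PoszD addrK.
Qed.

Lemma core_of_inj t : injective (@core_of t).
Proof.
move=> x y /(congr1 beta); rewrite !beta_core_of => e.
apply: eq_from_tnth => i.
have h k : (k < tnth x i) = (k < tnth y i) by rewrite -!mem_abacus e.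
by have := h (tnth x i); have := h (tnth y i); lia.
Qed.

(** The length of runner i is the first k for which i.+1 + k t is missing. *)
Lemma closed_abacus t (X : seq nat) : 0 < t -> sorted gtn X -> all (leq 1) X ->
    (forall y, y \in X -> t <= y -> y - t \in X) ->
  exists x : t.-1.-tuple nat, abacus x = X.
Proof.
move=> t0 sX X0 closedX.
have down j y : y \in X -> j * t <= y -> y - j * t \in X.
  elim: j y => [|j IH] y yX jy; first by rewrite subn0.
  rewrite mulSn subnDA; apply: IH; last by lia.
  by apply: closedX => //; lia.
have ex (i : 'I_t.-1) : exists k, i.+1 + k * t \notin X.
  (* No element of X exceeds the sum of X. *)
  exists (sumn X); apply/negP => /perm_to_rem /perm_sumn /=.
  nia.
pose x := [tuple ex_minn (ex i) | i < t.-1].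
have memX (i : 'I_t.-1) k : (i.+1 + k * t \in X) = (k < tnth x i).
  rewrite tnth_mktuple; case: ex_minnP => m mX min_m; apply/idP/idP.
    move=> kX; rewrite ltnNge; apply/negP => mk; move/negP: mX; apply.
    have := down (k - m) _ kX.
    have -> : i.+1 + k * t - (k - m) * t = i.+1 + m * t.
      by rewrite mulnBl; have := leq_mul2r t m k; lia.
    by apply; rewrite mulnBl; lia.
  by rewrite ltnNge; apply: contraNT => /min_m.
exists x.
apply: (irr_sorted_eq (rev_trans ltn_trans) ltnn (sorted_abacus x) sX).
move=> y; apply/mem_abacusP/idP => [[i [k [kx ->]]]|yX]; first by rewrite memX.
(* The residue of y lies in X, so it is not 0 and y is on one of the runners. *)
have := down (y %/ t) _ yX (leq_trunc_div _ _).
rewrite {1}(divn_eq y t) addKn => /(allP X0) /= mod_gt0.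
have lt_i : (y %% t).-1 < t.-1 by have := ltn_pmod y t0; lia.
have ey : y = (Ordinal lt_i).+1 + y %/ t * t.
  by rewrite /= prednK // addnC -divn_eq.
by exists (Ordinal lt_i), (y %/ t); rewrite -memX -ey.
Qed.

Lemma core_of_bij t n : 0 < t ->
  set_bij [set x | C_set t x /\ C_exponent x = Posz n]%classic
          (distinct_cores t n) (@core_of t).
Proof.
move=> t0; split.
- move=> x [/= Cx]; rewrite C_exponentE => -[e].
  have px := is_partition_core_of x.
  split=> //.
    apply/(uniq_beta_nonconsecutive px); rewrite beta_core_of.
    exact/C_set_nonconsecutive.
  apply/(is_core_beta_closed t0 px); rewrite beta_core_of.
  exact: abacus_closed.
- by move=> x y _ _; apply: core_of_inj.
- move=> la [pla ula sla cla].
  have /andP[s p] := beta_sorted_gt0 pla.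
  have [x ex] := closed_abacus t0 s p ((is_core_beta_closed t0 pla).1 cla).
  have cx : core_of x = la by rewrite /core_of ex betaK.
  exists x => //=; split; last by rewrite C_exponentE cx sla.
  by apply/C_set_nonconsecutive; rewrite ex; apply/uniq_beta_nonconsecutive.
Qed.

Local Open Scope classical_set_scope.
Local Open Scope ring_scope.

(** * Rearranging summable families of power series *)

Lemma fps_summable_image (I J : choiceType) (A : set J) (D : set I)
    (h : J -> I) (f : I -> fps) :
  set_inj A h -> (forall j, A j -> D (h j)) -> fps_summable D f ->
  fps_summable A (f \o h).
Proof.
move=> inj_h AD sf n; rewrite -(eq_finite_set (inj_card_eq (_ : set_inj _ h))).
  by apply: sub_finite_set (sf n) => _ [j [Aj fj] <-]; split; [apply: AD|].
by move=> x y; rewrite !inE => -[Ax _] [Ay _]; apply: inj_h; rewrite inE.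
Qed.

Lemma fps_sum_bij (I J : choiceType) (A : set J) (D : set I) (h : J -> I)
    (f : I -> fps) :
  set_bij A D h -> fps_sum D f = fps_sum A (f \o h).
Proof. by move=> bij_h; apply: funext => n; apply: reindex_fsbig. Qed.

(** [fsbigU0] asks for finite index sets, so both parts are first cut down to
    the supports at the coefficient considered. *)
Lemma fps_sum_image2 (I J1 J2 : choiceType) (D : set I)
    (A1 : set J1) (A2 : set J2) (h1 : J1 -> I) (h2 : J2 -> I) (f : I -> fps) :
  set_inj A1 h1 -> set_inj A2 h2 -> D = h1 @` A1 `|` h2 @` A2 ->
  (forall a b, A1 a -> A2 b -> h1 a <> h2 b) -> fps_summable D f ->
  fps_sum D f = fps_sum A1 (f \o h1) + fps_sum A2 (f \o h2).
Proof.
move=> inj1 inj2 eD dis sf; apply: funext => n.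
change (fps_sum D f n = fps_sum A1 (f \o h1) n + fps_sum A2 (f \o h2) n).
rewrite /fps_sum /=.
rewrite -(fsbig_image A1 h1 (f ^~ n)) // -(fsbig_image A2 h2 (f ^~ n)) //.
rewrite [LHS]fsbig_supp [X in _ = X + _]fsbig_supp [X in _ = _ + X]fsbig_supp.
have fin (A : set I) : A `<=` D -> finite_set (A `&` (f ^~ n) @^-1` [set~ 0]).
  by move=> AD; apply: sub_finite_set (sf n) => i [Ai fi]; split; [apply: AD|].
have [s1 s2] : h1 @` A1 `<=` D /\ h2 @` A2 `<=` D.
  by rewrite eD; split; [apply: subsetUl|apply: subsetUr].
rewrite eD setIUl (fsbigU0 _ _ (fin _ s1) (fin _ s2)) //.
by move=> i [[[a Aa <-] _] [[b Ab e] _]]; apply: (dis a b).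
Qed.

(** A nonzero coefficient of an inner sum forces a nonzero term. *)
Lemma fps_summable_pair (I J : choiceType) (f : I -> J -> fps) :
  fps_summable [set: I * J] (fun p => f p.1 p.2) ->
  fps_summable [set: I] (fun i => fps_sum [set: J] (f i)).
Proof.
move=> sf n; apply: sub_finite_set (finite_image fst (sf n)) => i [_ fi].
apply: contrapT => ni; apply: fi; apply: fsbig1 => j _.
by apply: contrapT => fij; apply: ni; exists (i, j).
Qed.

(** For each coefficient only finitely many pairs contribute, and the double
    sum can be restricted to the product of the two projections of this finite
    set, where [pair_fsbig] applies. *)
Lemma fps_sum_pair (I J : choiceType) (f : I -> J -> fps) :
  fps_summable [set: I * J] (fun p => f p.1 p.2) ->
  fps_sum [set: I] (fun i => fps_sum [set: J] (f i)) =
  fps_sum [set: I * J] (fun p => f p.1 p.2).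
Proof.
move=> sf; apply: funext => n; rewrite /fps_sum.
pose S := [set p : I * J | setT p /\ f p.1 p.2 n <> 0].
have f0 i j : ~ S (i, j) -> f i j n = 0.
  by move=> nS; apply: contrapT => fij; apply: nS.
have finS : finite_set S := sf n.
rewrite -(fsbig_widen (fst @` S) [set: I]) //; last first.
  move=> i [_ /= ni]; apply: fsbig1 => j _; apply: f0 => Sij.
  by apply: ni; exists (i, j).
under eq_fsbigr => i _.
  rewrite -(fsbig_widen (snd @` S) [set: J]) //; last first.
    by move=> j [_ /= nj]; apply: f0 => Sij; apply: nj; exists (i, j).
  over.
rewrite /= (pair_fsbig _ (fun i j => f i j n)); try exact: finite_image.
apply: fsbig_widen => // -[i j] [_ /= nij]; apply: f0 => Sij.
by apply: nij; split; exists (i, j).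
Qed.

(** * The generating function as a sum over tuples *)

Lemma qpow_neq0 k n : qpow k n <> 0 -> k = n%:Z.
Proof. by rewrite /qpow; case: eqP => // ->. Qed.

Lemma summable_C_exponent t : (0 < t)%N ->
  fps_summable (C_set t) (fun x => qpow (C_exponent x)).
Proof.
move=> t_gt0 n; have [fun_c _ _] := core_of_bij n t_gt0.
rewrite -(eq_finite_set (inj_card_eq (_ : set_inj _ (@core_of t)))).
  apply: sub_finite_set (finite_distinct_cores t n).
  move=> _ [x [Cx /qpow_neq0 ex] <-].
  exact: fun_c.
by move=> x y _ _; apply: core_of_inj.
Qed.

(** The coefficient of q ^ n on the right counts the tuples of exponent n, and
    [core_of_bij] matches them with the partitions counted on the left. *)
Lemma genfun_cd t : (0 < t)%N ->
  genfun (cd t) = fps_sum (C_set t) (fun x => qpow (C_exponent x)).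
Proof.
move=> t_gt0; apply: funext => n; rewrite /genfun /fps_sum /cd.
pose S := [set x : t.-1.-tuple nat | C_set t x /\ C_exponent x = n%:Z].
rewrite -(fsbig_widen S); first last.
- move=> x [Cx nS] /=; apply: contrapT => /qpow_neq0 ex; exact: nS.
- by move=> x [].
transitivity (\sum_(x \in S) (1 : int)); last first.
  by apply: eq_fsbigr => x; rewrite inE => -[_ ->]; rewrite /qpow eqxx.
rewrite -(reindex_fsbig _ _ _ (fun=> 1 : int) (core_of_bij n t_gt0)).
rewrite fsbig_finite /=; last exact: finite_distinct_cores.
by rewrite big_const_seq count_predT iter_addr_0 -natz.
Qed.

(** * The cases t = 2, 3, 4 *)

Lemma double_bin2 n : 2 * 'C(n, 2)%:Z = n%:Z * (n%:Z - 1).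
Proof. by elim: n => // n IH; rewrite binS bin1; lia. Qed.

Lemma C_set2 : C_set 2 = [set: 1.-tuple nat].
Proof. by apply/seteqP; split=> // x _ [[|i] lt_i] [[|j] lt_j]. Qed.

Lemma C_exponent2 n : C_exponent (t := 2) [tuple n] = 'C(n.+1, 2)%:Z.
Proof.
rewrite /C_exponent !big_ord_recl !big_ord0 !(tnth_nth 0%N) /=.
rewrite !addn0 binS bin1; lia.
Qed.

Lemma bij_C_set2 :
  set_bij [set: nat] (C_set 2) (fun n => [tuple n] : 1.-tuple nat).
Proof.
rewrite C_set2; split=> //; first by move=> m n _ _ [].
by move=> x _; case/tupleP: x => n x; exists n; rewrite // (tuple0 x).
Qed.

(** The empty core is put in the second family, as in the sums of the theorem;
    this makes the two families disjoint. *)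
Lemma C_set3 : C_set 3 =
  (fun n => [tuple n; 0%N] : 2.-tuple nat) @` [set n | (1 <= n)%N]
  `|` (fun n => [tuple 0%N; n] : 2.-tuple nat) @` [set: nat].
Proof.
apply/seteqP; split=> [x Cx|x].
  have := Cx (@Ordinal 2 0 isT) (@Ordinal 2 1 isT) erefl.
  rewrite !(tnth_nth 0%N) /=.
  case: x {Cx} => -[|a [|b []]] //= sz /eqP; rewrite muln_eq0.
  case: a sz => [|a] sz /= b0; [right; exists b|left; exists a.+1] => //.
    exact: val_inj.
  by apply: val_inj; rewrite /= (eqP b0).
by case=> -[n _ <-] [[|[|i]] lt_i] [[|[|j]] lt_j] //= _;
  rewrite !(tnth_nth 0%N) /= ?muln0.
Qed.

Lemma C_exponent3l n : C_exponent (t := 3) [tuple n; 0%N] = (n ^ 2)%N%:Z.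
Proof.
rewrite /C_exponent !big_ord_recl !big_ord0 !(tnth_nth 0%N) /=.
rewrite !(bin0n, muln0, addn0, add0n) /bump /=.
have := double_bin2 n; rewrite -mulnn; nia.
Qed.

Lemma C_exponent3r n :
  C_exponent (t := 3) [tuple 0%N; n] = (2 * 'C(n.+1, 2))%N%:Z.
Proof.
rewrite /C_exponent !big_ord_recl !big_ord0 !(tnth_nth 0%N) /=.
rewrite !(bin0n, muln0, addn0, add0n) /bump /=.
rewrite binS bin1; lia.
Qed.

Lemma C_set4 : C_set 4 =
  (fun n => [tuple 0%N; n; 0%N] : 3.-tuple nat) @` [set n | (1 <= n)%N]
  `|` (fun p => [tuple p.1; 0%N; p.2] : 3.-tuple nat) @` [set: nat * nat].
Proof.
apply/seteqP; split=> [x Cx|x].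
  have := Cx (@Ordinal 3 0 isT) (@Ordinal 3 1 isT) erefl.
  have := Cx (@Ordinal 3 1 isT) (@Ordinal 3 2 isT) erefl.
  rewrite !(tnth_nth 0%N) /=.
  case: x {Cx} => -[|a [|b [|c []]]] //= sz /eqP + /eqP; rewrite !muln_eq0.
  case: b sz => [|b] sz /=; first by right; exists (a, c) => //; apply: val_inj.
  rewrite orbF => /eqP c0 /eqP a0; left; exists b.+1 => //.
  by apply: val_inj; rewrite /= a0 c0.
by case=> -[n _ <-] [[|[|[|i]]] lt_i] [[|[|[|j]]] lt_j] //= _;
  rewrite !(tnth_nth 0%N) /= ?muln0.
Qed.

Lemma C_exponent4l n :
  n%:Z * (3 * n%:Z + 1) = C_exponent (t := 4) [tuple 0%N; n; 0%N] * 2.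
Proof.
rewrite /C_exponent !big_ord_recl !big_ord0 !(tnth_nth 0%N) /=.
rewrite !(bin0n, muln0, addn0, add0n) /bump /=.
have := double_bin2 n; lia.
Qed.

Lemma C_exponent4r n m :
  n%:Z * (3 * n%:Z - 1) + 3 * m%:Z * (m%:Z + 1) - 2 * m%:Z * n%:Z =
  C_exponent (t := 4) [tuple n; 0%N; m] * 2.
Proof.
rewrite /C_exponent !big_ord_recl !big_ord0 !(tnth_nth 0%N) /=.
rewrite !(bin0n, muln0, addn0, add0n) /bump /=.
have := double_bin2 n; have := double_bin2 m; have := double_bin2 (n + m)%N.
nia.
Qed.

Theorem theorem1p1 :
  [/\ forall t : nat, (2 <= t)%N ->
        [/\ forall x, C_set t x -> 0 <= C_exponent x,
            fps_summable (C_set t) (fun x => qpow (C_exponent x))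
          & genfun (cd t) =
            fps_sum (C_set t) (fun x => qpow (C_exponent x))],
      fps_summable [set: nat] (fun n => qpow 'C(n.+1, 2)%:Z) /\
      genfun (cd 2) = fps_sum [set: nat] (fun n => qpow 'C(n.+1, 2)%:Z),
      [/\ fps_summable [set n | (1 <= n)%N] (fun n : nat => qpow (n ^ 2)%N%:Z),
          fps_summable [set: nat] (fun n => qpow (2 * 'C(n.+1, 2))%N%:Z)
        & genfun (cd 3) =
          fps_sum [set n | (1 <= n)%N] (fun n : nat => qpow (n ^ 2)%N%:Z)
          + fps_sum [set: nat] (fun n => qpow (2 * 'C(n.+1, 2))%N%:Z)]
    & let e1 (n : nat) : int := (n%:Z * (3 * n%:Z + 1) %/ 2)%Z in
      let e2 (n m : nat) : int :=
        ((n%:Z * (3 * n%:Z - 1) + 3 * m%:Z * (m%:Z + 1)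
          - 2 * m%:Z * n%:Z) %/ 2)%Z in
      [/\ (forall n, (2 %| n%:Z * (3 * n%:Z + 1))%Z) /\
          (forall n m, (2 %| n%:Z * (3 * n%:Z - 1) + 3 * m%:Z * (m%:Z + 1)
                             - 2 * m%:Z * n%:Z)%Z /\ 0 <= e2 n m),
          fps_summable [set n | (1 <= n)%N] (fun n => qpow (e1 n)),
          (forall n, fps_summable [set: nat] (fun m => qpow (e2 n m))),
          fps_summable [set: nat]
            (fun n => fps_sum [set: nat] (fun m => qpow (e2 n m)))
        & genfun (cd 4) =
          fps_sum [set n | (1 <= n)%N] (fun n => qpow (e1 n))
          + fps_sum [set: nat]
              (fun n => fps_sum [set: nat] (fun m => qpow (e2 n m)))]].
Proof.
split.
- move=> t t_ge2; have t_gt0 : (0 < t)%N by apply: ltnW.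
  split; [by move=> x _; rewrite C_exponentE| |exact: genfun_cd].
  exact: summable_C_exponent.
- have -> : (fun n => qpow 'C(n.+1, 2)%:Z) =
      (fun x : 1.-tuple nat => qpow (C_exponent (t := 2) x)) \o
      (fun n => [tuple n]).
    by apply: funext => n /=; rewrite C_exponent2.
  have [C_fun C_inj _] := bij_C_set2; split.
    exact: fps_summable_image C_inj C_fun (summable_C_exponent (ltn0Sn _)).
  by rewrite (genfun_cd (ltn0Sn _)) (fps_sum_bij _ bij_C_set2).
- set h1 := fun n : nat => [tuple n; 0%N]; set h2 := fun n => [tuple 0%N; n].
  pose f := fun x : 2.-tuple nat => qpow (C_exponent (t := 3) x).
  have -> : (fun n => qpow (n ^ 2)%N%:Z) = f \o h1.
    by apply: funext => n; rewrite /f /= C_exponent3l.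
  have -> : (fun n => qpow (2 * 'C(n.+1, 2))%N%:Z) = f \o h2.
    by apply: funext => n; rewrite /f /= C_exponent3r.
  have sf : fps_summable (C_set 3) f := summable_C_exponent (ltn0Sn _).
  have inj1 : set_inj [set n | (1 <= n)%N] h1 by move=> m n _ _ [].
  have inj2 : set_inj setT h2 by move=> m n _ _ [].
  split.
  + apply: fps_summable_image inj1 _ sf => n n_gt0.
    by rewrite C_set3; left; exists n.
  + apply: fps_summable_image inj2 _ sf => n _.
    by rewrite C_set3; right; exists n.
  + rewrite (genfun_cd (ltn0Sn _)) -/f; apply: fps_sum_image2 => //.
      exact: C_set3.
    by move=> a b /= a_gt0 _ [a0 _]; rewrite a0 in a_gt0.
- move=> e1 e2.
  set h1 := fun n : nat => [tuple 0%N; n; 0%N].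
  set h2 := fun p : nat * nat => [tuple p.1; 0%N; p.2].
  pose f := fun x : 3.-tuple nat => qpow (C_exponent (t := 4) x).
  have e1E : (fun n => qpow (e1 n)) = f \o h1.
    by apply: funext => n; rewrite /e1 C_exponent4l mulzK.
  have e2C n m : e2 n m = C_exponent (t := 4) (h2 (n, m)).
    by rewrite /e2 C_exponent4r mulzK.
  have e2E : (fun p => qpow (e2 p.1 p.2)) = f \o h2.
    by apply: funext => -[n m]; rewrite e2C.
  have sf : fps_summable (C_set 4) f := summable_C_exponent (ltn0Sn _).
  have inj1 : set_inj [set n | (1 <= n)%N] h1 by move=> m n _ _ [].
  have inj2 : set_inj setT h2 by move=> [a b] [c d] _ _ [-> ->].
  have sum2 : fps_summable [set: nat * nat] (fun p => qpow (e2 p.1 p.2)).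
    rewrite e2E; apply: fps_summable_image inj2 _ sf => p _.
    by rewrite C_set4; right; exists p.
  split.
  + split=> [n|n m]; first by rewrite C_exponent4l dvdz_mull.
    by rewrite C_exponent4r dvdz_mull // e2C C_exponentE.
  + rewrite e1E; apply: fps_summable_image inj1 _ sf => n n_gt0.
    by rewrite C_set4; left; exists n.
  + move=> n; apply: (fps_summable_image (h := pair n) _ _ sum2) => //.
    by move=> a b _ _ [].
  + exact: (fps_summable_pair (f := fun n m => qpow (e2 n m))).
  + rewrite (fps_sum_pair (f := fun n m => qpow (e2 n m))) // e1E e2E.
    rewrite (genfun_cd (ltn0Sn _)) -/f; apply: fps_sum_image2 => //.
      exact: C_set4.
    by move=> a [b c] /= a_gt0 _ [_ a0 _]; rewrite a0 in a_gt0.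
Qed.
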